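(* Let $L=(V,E)$ be a clutter such that (C1) no vertex of $V$ belongs to all edges of $L$, and (C2) every vertex of $V$ belongs to at least one edge of $L$. Then \[c(L)\geq \frac{1}{|V|-2\sqrt{|V|}+2}.\]
   Context: A clutter $L=(V,E)$ consists of a finite set $V$ (vertices) and a family $E$ of subsets of $V$ (edges) none of which is a subset of another. For an edge $e\in E$, a subset $e_0\subseteq e$ is a recognizing subset for $e$ if the only edge $e'\in E$ with $e_0\subseteq e'$ is $e'=e$. Letting $s_e$ be a smallest recognizing subset of $e$, define $c(e)=|s_e|/|e|$ and the hardness $c(L)=\max_{e\in E} c(e)$. *)

(* Defs.v *)
From mathcomp Require Import all_boot all_order all_algebra.

Set Implicit Arguments.
Unset Strict Implicit.
Unset Printing Implicit Defensive.

Import Order.TTheory GRing.Theory Num.Theory.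
Local Open Scope ring_scope.

(* The vertex set is the whole finite type [V]. *)
Record clutter (V : finType) := Clutter {
  edges : {set {set V}};
  edges_antichain :
    forall e f, e \in edges -> f \in edges -> e \subset f -> e = f
}.

Definition recognizing (V : finType) (L : clutter V) (e s : {set V}) : bool :=
  (s \subset e) && [forall f in edges L, (s \subset f) ==> (f == e)].

Lemma recognizing_self (V : finType) (L : clutter V) (e : {set V}) :
  e \in edges L -> recognizing L e e.
Proof.
move=> eL; rewrite /recognizing subxx; apply/forall_inP => f fL.
by apply/implyP => ef; rewrite (edges_antichain eL fL ef).
Qed.

(* By [recognizing_self] the starting point [e] of the minimization is legal
   whenever [e] is an edge. *)
Definition smallest_recognizing (V : finType) (L : clutter V) (e : {set V}) :
    {set V} :=
  [arg min_(s < e | recognizing L e s) #|s|].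

Definition edge_hardness (R : rcfType) (V : finType) (L : clutter V)
    (e : {set V}) : R :=
  #|smallest_recognizing L e|%:R / #|e|%:R.

(* All the values [edge_hardness R L e] are nonnegative, so the unit [0] does
   not affect the maximum as soon as there is an edge. *)
Definition hardness (R : rcfType) (V : finType) (L : clutter V) : R :=
  \big[Num.max/0]_(e in edges L) edge_hardness R L e.

(* Main.v *)
Require Import Defs.
From mathcomp Require Import all_boot all_order all_algebra.
From mathcomp Require Import zify lra.

(** Put [n = |V|] and [D = n - 2 sqrt n + 2]. Since [n <= 2 D], an edge without
recognizing singleton has hardness at least [2 / n >= 1 / D]. Otherwise each of
the [m] edges contains a vertex lying in no other edge. The remaining [n - m]
vertices lie in at most [m - 1] edges each by (C1), so the edge sizes sum to at
most [m + (n - m) (m - 1)], and by AM-GM some edge has size at most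
[n + 2 - (m + n / m) <= D]; its hardness is at least [1 / D]. *)

Set Implicit Arguments.
Unset Strict Implicit.
Unset Printing Implicit Defensive.

Import Order.TTheory GRing.Theory Num.Theory.
Local Open Scope ring_scope.

Section Clutter.
Variables (V : finType) (L : clutter V).
Implicit Types (e f s : {set V}) (v : V).

Definition degree v : nat := #|[set e in edges L | v \in e]|.

Lemma recognizing_uniq e f s :
  recognizing L e s -> f \in edges L -> s \subset f -> f = e.
Proof.
by case/andP=> _ /forall_inP He fL sf; have /implyP/(_ sf)/eqP := He f fL.
Qed.

Lemma smallest_recognizingP e :
  e \in edges L -> recognizing L e (smallest_recognizing L e).
Proof.
by move=> eL; rewrite /smallest_recognizing; case: arg_minnP;
  [apply: recognizing_self|].
Qed.

Lemma edge_hardness_le (R : rcfType) e :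
  e \in edges L -> edge_hardness R L e <= hardness R L.
Proof. by move=> eL; rewrite /hardness; apply: le_bigmax_cond. Qed.

(** Double counting of incident pairs. *)
Lemma sum_card_edges : (\sum_(e in edges L) #|e| = \sum_v degree v)%N.
Proof.
under eq_bigr do rewrite -sum1_card.
rewrite (exchange_big_dep predT) //=; apply: eq_bigr => v _.
by rewrite sum1_card; apply: eq_card => e; rewrite !inE.
Qed.

Hypothesis C1 : ~ exists v, forall e, e \in edges L -> v \in e.

Lemma degree_lt v : (degree v < #|edges L|)%N.
Proof.
apply: proper_card; rewrite properE; apply/andP; split.
  by apply/subsetP => e; rewrite inE => /andP[].
apply/negP => /subsetP Hv; apply: C1; exists v => e /Hv.
by rewrite inE => /andP[].
Qed.

Hypothesis C2 : forall v, exists2 e, e \in edges L & v \in e.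

(** If the empty set recognized [e], then [e] would be the only edge; by (C2) it would contain a
    vertex, which would then lie in all edges, against (C1). *)
Lemma recognizing_neq0 e s : (0 < #|V|)%N -> recognizing L e s -> s != set0.
Proof.
case/card_gt0P=> v _ Hs; apply/eqP => s0; rewrite s0 in Hs.
have Ee f : f \in edges L -> f = e.
  by move=> fL; apply: recognizing_uniq Hs fL (sub0set f).
have [f fL vf] := C2 v; apply: C1; exists v => g gL.
by rewrite (Ee g gL) -(Ee f fL).
Qed.

(** With [m] edges and [n] vertices this is [|e| <= n + 2 - (m + n / m)], cleared of the denominator
    and of subtractions. A smallest edge is at most the average size. *)
Lemma small_edge (p : {set V} -> V) :
    (0 < #|edges L|)%N ->
    (forall e, e \in edges L -> recognizing L e [set p e]) ->
  exists2 e, e \in edges L &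
    (#|edges L| * #|e| + #|V| + #|edges L| * #|edges L|
      <= #|edges L| * (#|V| + 2))%N.
Proof.
set m := #|edges L| => m_gt0 Hp.
have pin e : e \in edges L -> p e \in e.
  by move=> /Hp/andP[]; rewrite sub1set.
have puniq e f : e \in edges L -> f \in edges L -> p e \in f -> f = e.
  by move=> /Hp He fL pf; apply: recognizing_uniq He fL _; rewrite sub1set.
(* [P] collects one private vertex per edge: degree at most 1 on [P], at most [m - 1] off it. *)
pose P := p @: edges L.
have cardP : #|P| = m.
  apply: card_in_imset => e f eL fL epf; apply: (puniq f e) => //.
  by rewrite -epf pin.
have cardV : (m + #|~: P| = #|V|)%N by rewrite -cardP cardsC.
have degP v : v \in P -> (degree v <= 1)%N.
  case/imsetP=> e eL ->; rewrite -(cards1 e); apply: subset_leq_card.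
  apply/subsetP => f; rewrite !inE => /andP[fL pf]; apply/eqP.
  exact: puniq eL fL pf.
have sum_le : (\sum_(e in edges L) #|e| <= m + #|~: P| * m.-1)%N.
  rewrite sum_card_edges (bigID (mem P)) /=; apply: leq_add.
    by rewrite -cardP -sum1_card; apply: leq_sum => v; apply: degP.
  rewrite -sum_nat_const; under [leqRHS]eq_bigl do rewrite inE.
  by apply: leq_sum => v _; have := degree_lt v; rewrite -/m; case: (m).
have /card_gt0P [e0 e0L] := m_gt0.
case: (arg_minnP (fun e => #|e|) e0L) => e eL emin; exists e => //.
have : (m * #|e| <= \sum_(e in edges L) #|e|)%N.
  by rewrite -sum_nat_const; apply: leq_sum.
(* Writing [m = k + 1] turns [m.-1] into [k], leaving a polynomial inequality. *)
by move=> /leq_trans/(_ sum_le); rewrite -cardV;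
  case: (m) m_gt0 => //= k _; nia.
Qed.

End Clutter.

Theorem theorem1 (R : rcfType) (V : finType) (L : clutter V)
    (V_gt0 : (0 < #|V|)%N)
    (C1 : ~ exists v : V, forall e : {set V}, e \in edges L -> v \in e)
    (C2 : forall v : V, exists2 e : {set V}, e \in edges L & v \in e) :
  hardness R L >= 1 / (#|V|%:R - 2 * Num.sqrt #|V|%:R + 2).
Proof.
set r := Num.sqrt _.
have r2 : r ^+ 2 = #|V|%:R by rewrite sqr_sqrtr ?ler0n.
(* [D = (r - 1)^2 + 1]. *)
have D_gt0 : 0 < #|V|%:R - 2 * r + 2 by rewrite -r2; nra.
(* Used with [k = 2] and [k = 1], the two cases of the proof. *)
have large_hardness e (k : nat) : e \in edges L ->
    (k <= #|smallest_recognizing L e|)%N ->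
    #|e|%:R <= k%:R * (#|V|%:R - 2 * r + 2) ->
  1 / (#|V|%:R - 2 * r + 2) <= hardness R L.
  move=> eL kle ele; apply: le_trans (edge_hardness_le R eL).
  have rec_s := smallest_recognizingP eL.
  have s_gt0 : (0 < #|smallest_recognizing L e|)%N.
    by rewrite card_gt0 (recognizing_neq0 C1 C2 V_gt0 rec_s).
  have e_gt0 : (0 < #|e|)%N.
    by apply: leq_trans s_gt0 (subset_leq_card _); case/andP: rec_s.
  rewrite /edge_hardness ler_pdivrMr // mulrAC ler_pdivlMr ?ltr0n // mul1r.
  by apply: le_trans ele _; rewrite ler_pM2r // ler_nat.
have s_gt0 e : e \in edges L -> (0 < #|smallest_recognizing L e|)%N.
  by move=> eL; rewrite card_gt0
    (recognizing_neq0 C1 C2 V_gt0 (smallest_recognizingP eL)).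
have [/exists_inP[e eL s_ge2]|] :=
  boolP [exists e in edges L, 2 <= #|smallest_recognizing L e|]%N.
  apply: (large_hardness e 2%N eL s_ge2).
  apply: (@le_trans _ _ #|V|%:R); first by rewrite ler_nat max_card.
  (* [2 D - n = (r - 2)^2]. *)
  by rewrite -r2; have := sqr_ge0 (r - 2); nra.
rewrite negb_exists_in => /forall_inP s_lt2.
have /card_gt0P [v0 _] := V_gt0.
(* On edges the set is a singleton and [p e] its element; [v0] is only a default. *)
pose p e := odflt v0 [pick v in smallest_recognizing L e].
have Hp e : e \in edges L -> recognizing L e [set p e].
  move=> eL; have := smallest_recognizingP eL.
  have /cards1P[v sv] : #|smallest_recognizing L e| == 1%N.
    by rewrite eqn_leq s_gt0 // andbT leqNgt s_lt2.
  rewrite /p; case: pickP => [w|/(_ v)]; rewrite sv inE ?eqxx //.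
  by move=> /eqP ->.
have E_gt0 : (0 < #|edges L|)%N.
  by have [e eL _] := C2 v0; apply/card_gt0P; exists e.
have [e eL] := small_edge C1 E_gt0 Hp.
rewrite -(ler_nat R) !natrD !natrM natrD => small.
apply: (large_hardness e 1%N eL (s_gt0 e eL)); rewrite mul1r.
have m_gt0 : 0 < #|edges L|%:R :> R by rewrite ltr0n.
(* After multiplication by [m], [small] gives [m D - m |e| >= (r - m)^2]. *)
rewrite -(ler_pM2l m_gt0); rewrite -r2 in small *.
by have := sqr_ge0 (r - #|edges L|%:R); nra.
Qed.
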